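(* Let $\lambda=(\lambda_i)_{i\in\mathbb{N}}$ and $\mu=(\mu_i)_{i\in\mathbb{N}}$ be two non-decreasing sequences of positive integers such that $\lambda_i\le\mu_i$ for all $i\in\mathbb{N}$, and let $\alpha,\beta$ be fixed real numbers with $0<\alpha\le\beta\le 1$. Let $I$ be an admissible ideal on $\mathbb{N}$, $\theta$ a lacunary sequence, $\mathscr{M}=(M_j)$ a Musielak-Orlicz function, and $(\rho^{(j)})_{j\in\mathbb{N}}$ a fixed sequence of positive real numbers. If $$\liminf_{i\to\infty}\frac{\lambda_i^\alpha}{\mu_i^\beta}>0,$$ then $$S_{I_\mu}^\beta(\mathscr{M},\theta)\subseteq S_{I_\lambda}^\alpha(\mathscr{M},\theta).$$
   Context: Here $\mathbb{N}=\{1,2,3,\dots\}$. An ideal on $\mathbb{N}$ is a nonempty family $I$ of subsets of $\mathbb{N}$ such that $P,Q\in I$ implies $P\cup Q\in I$, and $P\in I$, $Q\subseteq P$ implies $Q\in I$. It is admissible if $\mathbb{N}\notin I$ and $I$ contains every finite subset of $\mathbb{N}$. A lacunary sequence is an increasing sequence of integers $\theta=(j_r)_{r\ge 0}$ with $j_0=0$ and $h_r=j_r-j_{r-1}\to\infty$ as $r\to\infty$; the numbers $h_r$ ($r\ge1$) are attached to $\theta$ in this way. An Orlicz function is a continuous, non-decreasing, convex function $M:[0,\infty)\to[0,\infty)$ with $M(0)=0$, $M(x)>0$ for $x>0$, and $M(x)\to\infty$ as $x\to\infty$. A Musielak-Orlicz function is a sequence $\mathscr{M}=(M_j)_{j\in\mathbb{N}}$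 of Orlicz functions. For a non-decreasing sequence $\lambda=(\lambda_i)$ of positive integers, put $I_i^{\lambda}=\{k\in\mathbb{N}: i-\lambda_i+1\le k\le i\}$. Let $\alpha\in(0,1]$. A sequence $(x_j)_{j\in\mathbb{N}}$ of real numbers is $I_\lambda$-lacunary statistically convergent of order $\alpha$ to $Z\in\mathbb{R}$ (with respect to $\mathscr{M}$, $\theta$ and $(\rho^{(j)})$) if for every $\gamma>0$ and every $\xi>0$, $$\left\{i\in\mathbb{N}:\ \frac{1}{\lambda_i^\alpha}\left|\left\{j\in\mathbb{N},\ j\le i:\ \frac{1}{h_i}\sum_{k\in I_i^{\lambda}}M_k\!\left(\frac{|x_k-Z|}{\rho^{(k)}}\right)\ge\gamma\right\}\right|\ge\xi\right\}\in I,$$ where $|\cdot|$ around a set denotes its cardinality (the condition inside the inner set does not depend on $j$, so the inner set is either $\{1,\dots,i\}$ or empty). $S_{I_\lambda}^\alpha(\mathscr{M},\theta)$ denotes the set of all real sequences that are $I_\lambda$-lacunary statistically convergent of order $\alpha$ to some $Z\in\mathbb{R}$. $S_{I_\mu}^\beta(\mathscr{M},\theta)$ is defined in the same way with $\mu$, $\beta$ in place of $\lambda$, $\alpha$. *)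

(* Defs.v *)
From HB Require Import structures.
From mathcomp Require Import all_boot all_order all_algebra finmap.
From mathcomp Require Import all_classical all_reals all_analysis.
Set Implicit Arguments.
Unset Strict Implicit.
Unset Printing Implicit Defensive.
Import Order.TTheory GRing.Theory Num.Theory.
Import numFieldNormedType.Exports.
Local Open Scope classical_set_scope.
Local Open Scope ring_scope.

(* The index set N = {1, 2, 3, ...}.  Families indexed by N are functions on
   [nat] whose value at 0 is never constrained and never used; an ideal on N is
   a family of subsets of [nat] all contained in [Npos]. *)
Definition Npos : set nat := [set n | (1 <= n)%N].

Definition is_ideal (I : set (set nat)) : Prop :=
  [/\ I !=set0,
      forall P, I P -> P `<=` Npos,
      forall P Q, I P -> I Q -> I (P `|` Q) &
      forall P Q, I P -> Q `<=` P -> I Q].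

Definition admissible_ideal (I : set (set nat)) : Prop :=
  [/\ is_ideal I,
      ~ I Npos &
      forall P, P `<=` Npos -> finite_set P -> I P].

(* h_r = j_r - j_(r-1), used for r >= 1 only; for an increasing [theta] the
   truncated subtraction of [nat] is the genuine one. *)
Definition gap (theta : nat -> nat) (r : nat) : nat :=
  (theta r - theta r.-1)%N.

(* An increasing sequence of integers starting at 0 takes its values in [nat];
   on [nat], [\oo] is the filter of neighbourhoods of infinity. *)
Definition lacunary (theta : nat -> nat) : Prop :=
  [/\ theta 0 = 0%N,
      {homo theta : r s / (r < s)%N} &
      gap theta r @[r --> \oo] --> \oo].

(* An Orlicz function [0, +oo[ -> [0, +oo[ is a function on R constrained (and
   evaluated) on [0, +oo[ only. *)
Record orlicz (R : realType) (M : R -> R) : Prop := Orlicz {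
  orlicz_ge0 : {in `[0, +oo[, forall x, 0 <= M x};
  orlicz_continuous : {within `[0, +oo[, continuous M};
  orlicz_nondecreasing : {in `[0, +oo[ &, {homo M : x y / x <= y}};
  orlicz_convex : convex_function (`[0, +oo[%classic : set R^o) M;
  orlicz0 : M 0 = 0;
  orlicz_gt0 : forall x : R, 0 < x -> 0 < M x;
  orlicz_cvgy : M x @[x --> +oo] --> +oo
}.

Definition musielak_orlicz (R : realType) (M : nat -> R -> R) : Prop :=
  forall j, Npos j -> orlicz (M j).

Definition nondecreasing_positive (lam : nat -> nat) : Prop :=
  (forall i, Npos i -> (0 < lam i)%N) /\
  {in Npos &, {homo lam : i k / (i <= k)%N}}.

(* I_i^lambda; the bound i - lambda_i + 1 may be negative, so it is taken in
   the integers. *)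
Definition window (lam : nat -> nat) (i : nat) : set nat :=
  [set k | Npos k /\ (i%:Z - (lam i)%:Z + 1 <= k%:Z <= i%:Z)].

Definition modular_mean (R : realType) (M : nat -> R -> R)
    (theta : nat -> nat) (rho : nat -> R) (lam : nat -> nat)
    (x : nat -> R) (Z : R) (i : nat) : R :=
  ((gap theta i)%:R)^-1 *
    \sum_(k \in window lam i) M k (`|x k - Z| / rho k).

(* [j] does not occur in the last condition on [j]. *)
Definition lacunary_stat_cvg (R : realType) (I : set (set nat))
    (M : nat -> R -> R) (theta : nat -> nat) (rho : nat -> R)
    (lam : nat -> nat) (alpha : R) (x : nat -> R) (Z : R) : Prop :=
  forall gamma xi : R, 0 < gamma -> 0 < xi ->
    I [set i | Npos i /\
         xi <= ((lam i)%:R `^ alpha)^-1 *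
               (#|` fset_set [set j | [/\ Npos j, (j <= i)%N &
                    gamma <= modular_mean M theta rho lam x Z i]]|)%:R].

Definition lacunary_stat_space (R : realType) (I : set (set nat))
    (M : nat -> R -> R) (theta : nat -> nat) (rho : nat -> R)
    (lam : nat -> nat) (alpha : R) : set (nat -> R) :=
  [set x | exists Z : R, lacunary_stat_cvg I M theta rho lam alpha x Z].

(* Main.v *)
Require Import Defs.
From HB Require Import structures.
From mathcomp Require Import all_boot all_order all_algebra finmap.
From mathcomp Require Import all_classical all_reals all_analysis.
From mathcomp Require Import zify.
Import Order.TTheory GRing.Theory Num.Theory.
Import numFieldNormedType.Exports.
Local Open Scope classical_set_scope.
Local Open Scope ring_scope.

(** Fix [x] and a [mu]-limit [Z]; the same [Z] works for [lam].  Since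
    [lam <= mu], the [lam]-window ending at [i] lies inside the [mu]-window
    ending at [i], and a Musielak-Orlicz modular has nonnegative terms, so the
    [lam]-mean of [x - Z] is at most the [mu]-mean ([modular_mean_le]).  Hence
    the set counted for [lam] at level [gamma] is contained in the one counted
    for [mu].  The normalisations are compared through the lower limit: it
    gives [c > 0] with [c * mu_i ^ beta <= lam_i ^ alpha] for all large [i]
    ([limn_einf_gt0_near]), so a [lam]-density at least [xi] forces a
    [mu]-density at least [c * xi].  The exceptional set of [lam] at
    [(gamma, xi)] is therefore covered by the exceptional set of [mu] at
    [(gamma, c * xi)] and a finite set, both of which belong to the ideal. *)

(** The lower limit is the supremum of the tail infima, so a positive lower
    limit makes some tail infimum positive; being below a real value, that
    infimum cannot be [+oo] and serves as the constant. *)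
Lemma limn_einf_gt0_near (R : realType) (u : nat -> R) :
  (0 < limn_einf (fun i => (u i)%:E))%E ->
  exists2 c : R, 0 < c & \forall i \near \oo, c <= u i.
Proof.
rewrite limn_einf_lim (cvg_lim (@ereal_hausdorff R) (@cvg_einfs_sup R _)).
move=> /ereal_sup_gt[_ [n _ <-]] einf_gt0.
have einf_le i : (n <= i)%N -> (einfs (fun i => (u i)%:E) n <= (u i)%:E)%E.
  by move=> ni; apply: ereal_inf_lbound; exists i.
case: einfs einf_gt0 einf_le => [c||] // c0 cu.
- by exists c; [rewrite -lte_fin | exists n => // i /cu; rewrite lee_fin].
- by have := cu n (leqnn n).
Qed.

Lemma le_fsum_nneg_subset (R : realDomainType) (T : choiceType) (A B : set T)
    (f : T -> R) : finite_set B -> A `<=` B -> (forall t, B t -> 0 <= f t) ->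
  \sum_(t \in A) f t <= \sum_(t \in B) f t.
Proof.
move=> finB AB f0; rewrite (fsbigID A B) // setIidr // lerDl.
by apply: fsumr_ge0 => t [/f0].
Qed.

Lemma finite_window (lam : nat -> nat) i : finite_set (window lam i).
Proof.
by apply: (sub_finite_set _ (finite_II i.+1)) => k -[_ /=]; lia.
Qed.

Lemma window_subset (lam mu : nat -> nat) i : (lam i <= mu i)%N ->
  window lam i `<=` window mu i.
Proof. by move=> le_i k [k1 kP]; split=> //; lia. Qed.

Lemma modular_mean_le (R : realType) (M : nat -> R -> R)
    (theta : nat -> nat) (rho : nat -> R) (lam mu : nat -> nat)
    (x : nat -> R) (Z : R) (i : nat) :
  musielak_orlicz M -> (forall j, Npos j -> 0 < rho j) -> (lam i <= mu i)%N ->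
  modular_mean M theta rho lam x Z i <= modular_mean M theta rho mu x Z i.
Proof.
move=> hM hrho le_i; rewrite /modular_mean ler_wpM2l ?invr_ge0 //.
apply: le_fsum_nneg_subset; [exact: finite_window | exact: window_subset |].
move=> k [k1 _]; apply: (orlicz_ge0 (hM k k1)).
by rewrite in_itv /= andbT divr_ge0 // ltW // hrho.
Qed.

Lemma card_initial_segment_le (P Q : Prop) (i : nat) : (P -> Q) ->
  (#|` fset_set [set j | [/\ Npos j, (j <= i)%N & P]]| <=
   #|` fset_set [set j | [/\ Npos j, (j <= i)%N & Q]]|)%N.
Proof.
move=> PQ.
have fin S : finite_set [set j | [/\ Npos j, (j <= i)%N & S]].
  by apply: (sub_finite_set _ (finite_II i.+1)) => j -[].
apply: fsubset_leq_card; rewrite -fset_set_sub //.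
by move=> j [j1 ji /PQ].
Qed.

(** Admissibility lets finitely many indices be ignored. *)
Lemma admissible_ideal_near (I : set (set nat)) (A B : set nat) :
  admissible_ideal I -> A `<=` Npos -> I B ->
  (\forall i \near \oo, A i -> B i) -> I A.
Proof.
move=> [[_ _ IU IS] _ Ifin] A1 IB [n _ AB].
have IF : I (A `&` `I_n).
  by apply: Ifin => [i [/A1]|] //; apply: finite_setIr; exact: finite_II.
apply: IS (IU _ _ IB IF) _ => i Ai.
by have [ni|ni] := leqP n i; [left; apply: AB | right].
Qed.

Theorem theorem0p1 (R : realType) (lam mu : nat -> nat) (alpha beta : R)
    (I : set (set nat)) (theta : nat -> nat) (M : nat -> R -> R)
    (rho : nat -> R)
    (hlam : nondecreasing_positive lam) (hmu : nondecreasing_positive mu)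
    (hlammu : forall i, Npos i -> (lam i <= mu i)%N)
    (halpha : 0 < alpha) (halphabeta : alpha <= beta) (hbeta : beta <= 1)
    (hI : admissible_ideal I) (htheta : lacunary theta)
    (hM : musielak_orlicz M) (hrho : forall j, Npos j -> 0 < rho j)
    (hliminf : (0 < limn_einf (fun i : nat =>
       ((lam i)%:R `^ alpha / (mu i)%:R `^ beta)%:E))%E) :
  lacunary_stat_space I M theta rho mu beta `<=`
  lacunary_stat_space I M theta rho lam alpha.
Proof.
move=> x [Z xZ]; exists Z => gamma xi gamma0 xi0.
have [c c0 cP] := limn_einf_gt0_near _ _ hliminf.
apply: (admissible_ideal_near _ _ _ hI _
  (xZ gamma (c * xi) gamma0 (mulr_gt0 c0 xi0))).
  by move=> i [].
apply: filterS cP => i ci [i1 xiP]; split=> //.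
have powR_pos (nu : nat -> nat) (a : R) :
    nondecreasing_positive nu -> 0 < (nu i)%:R `^ a.
  by move=> [nu0 _]; rewrite powR_gt0 // ltr0n nu0.
have lam0 := powR_pos lam alpha hlam; have mu0 := powR_pos mu beta hmu.
rewrite ler_pdivlMr // in ci; rewrite ler_pdivlMl // in xiP.
rewrite ler_pdivlMl // mulrA [_ * c]mulrC.
apply: (le_trans (ler_wpM2r (ltW xi0) ci)); apply: (le_trans xiP).
rewrite ler_nat; apply: card_initial_segment_le => gammaP.
exact/(le_trans gammaP)/modular_mean_le/hlammu.
Qed.
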